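(* Let the set $A_0$ be uniformly integrable relative to every measure $P\in M$. Suppose that for a nonnegative $\mathcal F_N$-measurable contingent claim $f_N$, $N<\infty$, integrable relative to every measure $P\in M$, there exist $\alpha_0<\infty$ and $\xi_0\in A_0$ such that $$P\big(f_N-\alpha_0E^P\{\xi_0|\mathcal F_N\}\le0\big)=1 .$$ Then the fair price $f_0$ of the contingent claim $f_N$ relative to $M$ exists, and $$\sup_{P\in M}E^Pf_N\le f_0 .$$ If $f_N\ge0$ and the super-martingale $\{f_m=\operatorname{ess\,sup}_{P\in M}E^P\{f_N|\mathcal F_m\},\mathcal F_m\}_{m=0}^\infty$ is local regular, then $f_0=\sup_{P\in M}E^Pf_N$.
   Context: Let $(\Omega,\mathcal F)$ be a measurable space with a filtration $\mathcal F_0\subset\mathcal F_1\subset\dots\subset\mathcal F$, where $\mathcal F_0=\{\emptyset,\Omega\}$, $\mathcal F=\sigma(\bigcup_{n\ge1}\mathcal F_n)$, and $M$ a convex set of pairwise equivalent probability measures on $\mathcal F$. Standing assumption: for all $P,Q\in M$ the density $\frac{dP}{dQ}$ is $\mathcal F_1$-measurable and $P_0\left(\frac{dP}{dQ}>0\right)=1$, where $P_0\in M$ is fixed. $A_0$ is the set of all nonnegative $M$-integrable random variables $\xi$ with $E^P\xi=1$ for all $P\in M$; for $\xi\in A_0$, $E^P\{\xi|\mathcal F_m\}$ does not depend on $P\in M$. Super-martingale relative to $M$: an adapted process with $E^P|f_m|<\infty$ for $m\ge1$ and $E^P\{f_m|\mathcal F_k\}\le f_k$ for all $0\le k\le m$,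 $P\in M$. It is local regular if $\sup_{P\in M}E^P|f_m|<\infty$ for $m\ge1$ and there is an adapted nonnegative increasing (non-decreasing in $m$) process $\{g_m\}$, $g_0=0$, $\sup_{P\in M}E^P|g_m|<\infty$ for $m\ge1$, such that $\{f_m+g_m,\mathcal F_m\}$ is a martingale relative to every measure from $M$. Fair price: let $f_N$ be an $\mathcal F_N$-measurable random variable, integrable relative to $M$, such that for some $0\le\alpha_0<\infty$ and $\xi_0\in A_0$, $P(f_N-\alpha_0E^P\{\xi_0|\mathcal F_N\}\le0)=1$. Put $$G_{\alpha_0}=\{\alpha\in[0,\alpha_0]:\ \exists\,\xi_\alpha\in A_0,\ P(f_N-\alpha E^P\{\xi_\alpha|\mathcal F_N\}\le0)=1\}.$$ The number $f_0=\inf_{\alpha\in G_{\alpha_0}}\alpha$ is called the fair price of the contingent claim $f_N$ relative to $M$ if there exist $\zeta_0\in A_0$ and sequences $\alpha_n\in[0,\alpha_0]$, $\xi_{\alpha_n}\in A_0$ such that $\alpha_n\to f_0$, $\xi_{\alpha_n}\to\zeta_0$ in probability as $n\to\infty$, and $P(f_N-\alpha_nE^P\{\xi_{\alpha_n}|\mathcal F_N\}\le0)=1$ for all $n\ge1$. *)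

(* Defs.v *)
From HB Require Import structures.
From mathcomp Require Import all_boot all_order all_algebra.
From mathcomp Require Import all_classical all_reals all_analysis.
Set Implicit Arguments.
Unset Strict Implicit.
Unset Printing Implicit Defensive.
Import Order.TTheory GRing.Theory Num.Theory.
Import numFieldNormedType.Exports.
Local Open Scope classical_set_scope.
Local Open Scope ring_scope.
Local Open Scope ereal_scope.

(* sub-sigma-algebras of the ambient measurable sets are plain set systems *)
Definition gmeasurable {d} {T : measurableType d} {R : realType}
    (G : set (set T)) (X : T -> R) : Prop :=
  forall B : set R, measurable B -> G (X @^-1` B).

Definition is_filtration {d} {T : measurableType d} (F : nat -> set (set T))
    : Prop :=
  [/\ forall n, sigma_algebra [set: T] (F n),
      forall m n, (m <= n)%N -> F m `<=` F n,
      F 0%N = [set set0; [set: T]] &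
      measurable = <<s \bigcup_(n in [set n | (1 <= n)%N]) F n >> ].

Definition is_cond_exp {d} {T : measurableType d} {R : realType}
    (P : probability T R) (G : set (set T)) (X Y : T -> R) : Prop :=
  [/\ gmeasurable G Y,
      P.-integrable [set: T] (EFin \o Y) &
      forall A, G A -> \int[P]_(x in A) (Y x)%:E = \int[P]_(x in A) (X x)%:E].

(* A chosen version of E^P{X | G}; the default value 0 is only reached when
   there is no version, which cannot happen for P-integrable X. *)
Definition cond_exp {d} {T : measurableType d} {R : realType}
    (P : probability T R) (G : set (set T)) (X : T -> R) : T -> R :=
  xget (cst 0%R) [set Y | is_cond_exp P G X Y].

(* Probabilities are functions on all subsets of T, so the mixture is only
   required to agree with a member of M on measurable sets. *)
Definition convex_probabilities {d} {T : measurableType d} {R : realType}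
    (M : set (probability T R)) : Prop :=
  forall P Q : probability T R, M P -> M Q ->
  forall t : R, (0 <= t <= 1)%R ->
  exists2 S : probability T R, M S &
    forall A, measurable A -> S A = t%:E * P A + (1 - t)%:E * Q A.

Definition pairwise_equivalent {d} {T : measurableType d} {R : realType}
    (M : set (probability T R)) : Prop :=
  forall P Q : probability T R, M P -> M Q -> P `<< Q /\ Q `<< P.

Definition density {d} {T : measurableType d} {R : realType}
    (P Q : probability T R) : T -> \bar R :=
  Radon_Nikodym (charge_of_finite_measure P) Q.

(* dP/dQ is defined up to Q-null sets: it is G-measurable when one of its
   versions is. *)
Definition densities_measurable_positive {d} {T : measurableType d}
    {R : realType} (G : set (set T)) (M : set (probability T R))
    (P0 : probability T R) : Prop :=
  forall P Q : probability T R, M P -> M Q ->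
  (exists2 h : T -> R, gmeasurable G h &
     {ae Q, forall x, density P Q x = (h x)%:E}) /\
  P0 [set x | 0 < density P Q x] = 1.

Definition A0 {d} {T : measurableType d} {R : realType}
    (M : set (probability T R)) : set (T -> R) :=
  [set xi | [/\ forall x, (0 <= xi x)%R,
                forall P, M P -> P.-integrable [set: T] (EFin \o xi) &
                forall P, M P -> 'E_P[xi] = 1]].

Definition uniformly_integrable {d} {T : measurableType d} {R : realType}
    (P : probability T R) (S : set (T -> R)) : Prop :=
  ereal_sup [set \int[P]_(x in [set x | (c < `|xi x|)%R]) (`|xi x|%R)%:E
            | xi in S] @[c --> +oo%R] --> 0.

Definition cvg_in_probability {d} {T : measurableType d} {R : realType}
    (P : probability T R) (X_ : nat -> T -> R) (X : T -> R) : Prop :=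
  forall eps : R, (0 < eps)%R ->
    P [set x | (eps <= `|X_ n x - X x|)%R] @[n --> \oo] --> 0.

Definition adapted {d} {T : measurableType d} {R : realType}
    (F : nat -> set (set T)) (f : nat -> T -> R) : Prop :=
  forall m, gmeasurable (F m) (f m).

(* Integrability is asked for m >= 1 only: F 0 is trivial in a filtration, so
   an adapted process has a constant value at time 0. *)
Definition supermartingale {d} {T : measurableType d} {R : realType}
    (F : nat -> set (set T)) (M : set (probability T R)) (f : nat -> T -> R)
    : Prop :=
  adapted F f /\
  forall P, M P ->
    (forall m, (1 <= m)%N -> P.-integrable [set: T] (EFin \o f m)) /\
    (forall k m, (k <= m)%N ->
       {ae P, forall x, (cond_exp P (F k) (f m) x <= f k x)%R}).

Definition martingale {d} {T : measurableType d} {R : realType}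
    (F : nat -> set (set T)) (P : probability T R) (f : nat -> T -> R)
    : Prop :=
  [/\ adapted F f,
      forall m, (1 <= m)%N -> P.-integrable [set: T] (EFin \o f m) &
      forall k m, (k <= m)%N ->
        {ae P, forall x, cond_exp P (F k) (f m) x = f k x}].

Definition local_regular {d} {T : measurableType d} {R : realType}
    (F : nat -> set (set T)) (M : set (probability T R)) (f : nat -> T -> R)
    : Prop :=
  [/\ supermartingale F M f,
      forall m, (1 <= m)%N ->
        ereal_sup [set 'E_P[fun x => `|f m x|%R] | P in M] < +oo &
      exists g : nat -> T -> R,
        [/\ [/\ adapted F g,
                forall m x, (0 <= g m x)%R,
                forall m n x, (m <= n)%N -> (g m x <= g n x)%R &
                forall x, g 0%N x = 0%R],
            forall m, (1 <= m)%N ->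
              ereal_sup [set 'E_P[fun x => `|g m x|%R] | P in M] < +oo &
            forall P, M P -> martingale F P (fun m x => f m x + g m x)%R]].

(* f is a version of the P-essential supremum of the family S of random
   variables, i.e. its least upper bound for the P-a.s. order. This is not the
   library's ess_sup, which is the essential supremum of a single function. *)
Definition is_family_ess_sup {d} {T : measurableType d} {R : realType}
    (P : probability T R) (S : set (T -> R)) (f : T -> R) : Prop :=
  [/\ measurable_fun [set: T] f,
      forall h, S h -> {ae P, forall x, (h x <= f x)%R} &
      forall g : T -> R, measurable_fun [set: T] g ->
        (forall h, S h -> {ae P, forall x, (h x <= g x)%R}) ->
        {ae P, forall x, (f x <= g x)%R}].

(* P(fN - alpha E^P{xi | G} <= 0) = 1. For xi in A0 and the sigma-algebras of
   the filtration, E^P{xi | G} and null sets do not depend on P in M. *)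
Definition superhedged {d} {T : measurableType d} {R : realType}
    (M : set (probability T R)) (G : set (set T)) (fN : T -> R)
    (alpha : R) (xi : T -> R) : Prop :=
  forall P, M P ->
    P [set x | (fN x - alpha * cond_exp P G xi x <= 0)%R] = 1.

Definition price_set {d} {T : measurableType d} {R : realType}
    (M : set (probability T R)) (G : set (set T)) (fN : T -> R) (alpha0 : R)
    : set R :=
  [set alpha | (0 <= alpha <= alpha0)%R /\
     exists2 xi, A0 M xi & superhedged M G fN alpha xi].

Definition is_fair_price {d} {T : measurableType d} {R : realType}
    (M : set (probability T R)) (G : set (set T)) (fN : T -> R) (alpha0 : R)
    (f0 : R) : Prop :=
  f0 = inf (price_set M G fN alpha0) /\
  exists (zeta0 : T -> R) (alpha_ : nat -> R) (xi_ : nat -> T -> R),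
    [/\ A0 M zeta0,
        forall n, (0 <= alpha_ n <= alpha0)%R /\ A0 M (xi_ n),
        alpha_ n @[n --> \oo] --> f0,
        forall P, M P -> cvg_in_probability P xi_ zeta0 &
        forall n, superhedged M G fN (alpha_ n) (xi_ n)].

(* Main.v *)
(** A superhedging price is the common mean [alpha] of a nonnegative random
    variable [eta] with E^P eta = alpha for all P in M and E^P[fN; A] <=
    E^P[eta; A] for all A in F_N; these [eta] form a convex set, in which
    [alpha] is an affine function.

    The infimum [f0] of these prices is attained.  Choose [eta_k] with price at
    most f0 + 1/(k+1) nearly minimizing E exp(-eta).  Since

      (exp(-x) + exp(-y))/2 - exp(-(x+y)/2) = (exp(-x/2) - exp(-y/2))^2 / 2,

    convexity makes exp(-eta_k/2) a fast Cauchy sequence in L^2(P0), so [eta_k]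
    converges almost surely, with a finite limit by Fatou.  Uniform
    integrability of A0 turns this into convergence of the integrals over each
    event, for every P in M, so the limit superhedges at price [f0], and constant
    sequences witness the fair price.

    In the local regular case, X = f_m + g_m with m = max(N, 1) dominates [fN]
    and has the same mean under every P in M, namely the constant value of
    [f_0], which is at most sup_P E^P fN by minimality of the essential
    supremum.  So |X| superhedges at a price at most sup_P E^P fN. *)

Require Import Defs.
From HB Require Import structures.
From mathcomp Require Import all_boot all_order all_algebra.
From mathcomp Require Import all_classical all_reals all_analysis.
From mathcomp Require Import measurable_realfun ring lra.
Import Order.TTheory GRing.Theory Num.Theory.
Import numFieldNormedType.Exports.
Local Open Scope classical_set_scope.
Local Open Scope ring_scope.
Local Open Scope ereal_scope.

(** * Existence of conditional expectations *)

(** The identity from [T] to [T] with the sigma-algebra [G] is measurable, and pushing forward along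
    it restricts a measure to [G]. The Radon-Nikodym density of the restricted charge [A |->
    E[X; A]] with respect to the restricted [P] is therefore [G]-measurable and has the right
    integrals. *)
Lemma is_cond_exp_cond_exp {d} {T : measurableType d} {R : realType}
    (P : probability T R) (G : set (set T)) (X : T -> R) :
  sigma_algebra [set: T] G -> G `<=` measurable ->
  P.-integrable [set: T] (EFin \o X) -> is_cond_exp P G X (cond_exp P G X).
Proof.
move=> sG Gm intX; rewrite /cond_exp; apply: xgetPex.
have GE : measurable = G :> set (set (g_sigma_algebraType G)).
  exact: measurable_g_measurableTypeE.
have mid : measurable_fun [set: T] (id : T -> g_sigma_algebraType G).
  by move=> _ A; rewrite GE setTI => /Gm.
pose idG : {mfun T >-> g_sigma_algebraType G} :=
  HB.pack (id : T -> g_sigma_algebraType G)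
    (isMeasurableFun.Build _ _ _ _ _ mid).
pose mu : probability (g_sigma_algebraType G) R := distribution P idG.
pose nu_of :
  {charge set (g_sigma_algebraType G) -> \bar R} :=
  pushforward (induced_charge intX) idG.
pose nu := nu_of (measurable_funP idG).
have numu : nu `<< mu.
  apply/null_content_dominatesP => A; rewrite GE => /Gm mA.
  rewrite /mu /nu /distribution /pushforward /= => PA0.
  apply: (@null_set_integral _ T R P A _ mA _ PA0).
  exact: (measurable_funS measurableT (@subsetT _ _) (measurable_int _ intX)).
pose h : g_sigma_algebraType G -> \bar R := Radon_Nikodym nu mu.
have RNfin x : h x \is a fin_num by exact: Radon_Nikodym_fin_num.
have RNint : mu.-integrable [set: g_sigma_algebraType G] h.
  exact: Radon_Nikodym_integrable.
have /integrableP[mRN intyRN] := RNint.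
have mRN' : measurable_fun [set: T] (h \o idG).
  exact: measurableT_comp.
have hE : EFin \o (fine \o h) = h :> (T -> \bar R).
  by apply/funext => x /=; rewrite fineK.
have inth : P.-integrable [set: T] (h \o idG).
  apply/integrableP; split => //.
  move: intyRN; rewrite /mu /distribution ge0_integral_pushforward//=.
  exact: measurableT_comp.
exists (fine \o h); split.
- move=> B mB.
  have : measurable_fun [set: g_sigma_algebraType G] (fine \o h).
    exact: measurableT_comp.
  by move=> /(_ measurableT B mB); rewrite setTI GE.
- by rewrite hE.
- move=> A GA; have mA := Gm _ GA.
  have GA' : measurable (A : set (g_sigma_algebraType G)) by rewrite GE.
  transitivity (\int[P]_(x in A) h x).
    by apply: eq_integral => x _ /=; rewrite fineK.
  transitivity (nu A); last by [].
  rewrite (Radon_Nikodym_integral numu GA') /mu /distribution.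
  by rewrite integral_pushforward//; exact: integrableS inth.
Qed.

(** * Almost sure convergence of near minimizers in nested convex sets *)

(** The infima [J n] of [phi] over [D n] increase to a finite [S]. Far enough along the sequence,
    the midpoint of two near minimizers has value above [S - delta k], while both values lie below
    [S + delta k]. *)
Lemma near_minimizing_seq {X : Type} {R : realType} (D : nat -> set X)
    (phi : X -> R) (mid : X -> X -> X) (delta : nat -> R) :
  (forall m n, (m <= n)%N -> D n `<=` D m) ->
  (forall n, D n !=set0) ->
  (forall n x y, D n x -> D n y -> D n (mid x y)) ->
  (forall x, D 0%N x -> 0 <= phi x <= 1)%R ->
  (forall k, 0 < delta k)%R -> (forall k, delta k.+1 <= delta k)%R ->
  exists h : nat -> X, forall k, D k (h k) /\
    ((phi (h k) + phi (h k.+1)) / 2 - phi (mid (h k) (h k.+1))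
      <= 2 * delta k)%R.
Proof.
move=> Dnd Dne Dmid phi01 delta0 delta_nd.
have phi_ge0 n x : D n x -> (0 <= phi x)%R.
  by move=> /(Dnd _ _ (leq0n n)) /phi01/andP[].
have phi_le1 n x : D n x -> (phi x <= 1)%R.
  by move=> /(Dnd _ _ (leq0n n)) /phi01/andP[].
pose J n := inf (phi @` D n).
have hasinfJ n : has_inf (phi @` D n).
  split; first by have [x Dx] := Dne n; exists (phi x), x.
  by exists 0%R => _ [x Dx <-]; exact: phi_ge0 Dx.
have J_le n x : D n x -> (J n <= phi x)%R.
  by move=> Dx; apply: ge_inf; [case: (hasinfJ n)|exists x].
have J_nd m n : (m <= n)%N -> (J m <= J n)%R.
  move=> mn; apply: lb_le_inf; first by case: (hasinfJ n).
  by move=> _ [x Dx <-]; apply: J_le; exact: Dnd Dx.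
pose S := sup (range J).
have hassupJ : has_sup (range J).
  split; first by exists (J 0%N), 0%N.
  exists 1%R => _ [n _ <-]; have [x Dx] := Dne n.
  by apply: (le_trans (J_le _ _ Dx)); exact: phi_le1 Dx.
have J_leS n : (J n <= S)%R by apply: sup_upper_bound => //; exists n.
have /choice[N NP] k : exists N, (S - delta k < J N)%R.
  by have [_ [N _ <-] ?] := sup_adherent (delta0 k) hassupJ; exists N.
(* The sum makes the indices nondecreasing with [N k <= n_ k]; the extra [k] gives [k <= n_ k],
   hence [h k] in [D k]. *)
pose n_ k := (k + \sum_(i < k.+1) N i)%N.
have n_nd k : (n_ k <= n_ k.+1)%N.
  by rewrite /n_ [X in (_ <= _ + X)%N]big_ord_recr/= leq_add// leq_addr.
have NP' k : (S - delta k < J (n_ k))%R.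
  apply: (lt_le_trans (NP k)); apply: J_nd.
  by rewrite /n_ big_ord_recr/= addnA leq_addl.
have /choice[h hP] k : exists x, D (n_ k) x /\ (phi x < S + delta k)%R.
  have [_ [x Dx <-] xJ] := inf_adherent (delta0 k) (hasinfJ (n_ k)).
  exists x; split => //; apply: (lt_le_trans xJ).
  by rewrite lerD2r J_leS.
exists h => k; split; first by have [+ _] := hP k; apply: Dnd; rewrite leq_addr.
have [Dk hk] := hP k; have [Dk1 hk1] := hP k.+1.
have := J_le _ _ (Dmid _ _ _ Dk (Dnd _ _ (n_nd k) _ Dk1)).
have := NP' k; have := delta_nd k; lra.
Qed.

(** The increments have L^1 norms at most [2^-1 ^+ k], so the sum of their absolute values is
    integrable, hence finite almost everywhere; there the telescoping series converges
    absolutely. *)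
Lemma ae_cvgn_L2_fast {d} {T : measurableType d} {R : realType}
    (P : probability T R) (u : nat -> T -> R) :
  (forall k, measurable_fun [set: T] (u k)) ->
  (forall k, \int[P]_x ((u k.+1 x - u k x) ^+ 2)%:E <= (4^-1 ^+ k)%:E) ->
  {ae P, forall x, cvgn (u ^~ x)}.
Proof.
move=> mu_ hu.
pose v k x := `|u k.+1 x - u k x|%R.
have v0 k x : (0 <= v k x)%R by exact: normr_ge0.
have mv k : measurable_fun [set: T] (v k).
  by apply: measurableT_comp => //; exact: measurable_funB.
have mEv k : measurable_fun [set: T] (fun x => (v k x)%:E).
  exact/measurable_EFinP.
have intv k : \int[P]_x (v k x)%:E <= (2^-1 ^+ k)%:E.
  (* With this weight in AM-GM, the second moment is at most [a ^+ 2], and the two terms contribute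
     [a / 2] each. *)
  pose a : R := (2^-1 ^+ k)%R.
  have a0 : (0 < a)%R by rewrite exprn_gt0// invr_gt0.
  apply: (@le_trans _ _ (\int[P]_x ((a / 2)%:E +
      ((2 * a)^-1)%:E * ((u k.+1 x - u k x) ^+ 2)%:E))).
    apply: ge0_le_integral => //.
    - by move=> x _; rewrite lee_fin.
    - apply: emeasurable_funD => //; apply: measurable_funeM.
      apply/measurable_EFinP; apply: measurable_funX.
      exact: measurable_funB.
    - move=> x _; rewrite -EFinM -EFinD lee_fin /v.
      rewrite -[X in (_ <= _ + _ * X)%R]real_normK ?num_real//.
      set t := `|_|%R.
      (* AM-GM: [2 t <= a + t^2 / a] *)
      have -> : (a / 2 + (2 * a)^-1 * t ^+ 2 = t + (a - t) ^+ 2 / (2 * a))%R.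
        by field; rewrite gt_eqF.
      by rewrite lerDl divr_ge0 ?sqr_ge0// mulr_ge0// ltW.
  rewrite ge0_integralD//=; last 3 first.
  - by move=> x _; rewrite lee_fin divr_ge0// ltW.
  - by move=> x _; rewrite -EFinM lee_fin mulr_ge0 ?sqr_ge0// invr_ge0 mulr_ge0// ltW.
  - apply: measurable_funeM; apply/measurable_EFinP; apply: measurable_funX.
    exact: measurable_funB.
  rewrite integral_cst//= probability_setT mule1 ge0_integralZl_EFin//; last 3 first.
  - by move=> x _; rewrite lee_fin sqr_ge0.
  - by apply/measurable_EFinP; apply: measurable_funX; exact: measurable_funB.
  - by rewrite invr_ge0 mulr_ge0// ltW.
  apply: (@le_trans _ _ ((a / 2)%:E + ((2 * a)^-1)%:E * (4^-1 ^+ k)%:E)).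
    by rewrite leeD2l// lee_pmul2l// lte_fin invr_gt0 mulr_gt0.
  rewrite -EFinM -EFinD lee_fin.
  have -> : ((4^-1 : R) ^+ k = a ^+ 2)%R.
    by rewrite /a -exprM mulnC exprM; congr (_ ^+ k)%R; field.
  by rewrite -/a le_eqVlt; apply/orP; left; apply/eqP; field; rewrite gt_eqF.
have sumv : \int[P]_x (\sum_(k <oo) (v k x)%:E) < +oo.
  rewrite integral_nneseries//; last by move=> k x _; rewrite lee_fin.
  apply: (@le_lt_trans _ _ (\sum_(k <oo) (2^-1 ^+ k)%:E)).
    apply: lee_nneseries => [k _ _|k _]; last exact: intv.
    by apply: integral_ge0 => x _; rewrite lee_fin.
  have : cvgn (series (geometric (1 : R) 2^-1)).
    by apply: is_cvg_geometric_series; rewrite gtr0_norm// invf_lt1// ltr1n.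
  move=> /cvg_ex[l cl].
  rewrite (_ : \sum_(k <oo) _ = l%:E) ?ltry//.
  apply/cvg_lim => //.
  under eq_fun do rewrite sumEFin.
  apply: cvg_EFin; first by apply: nearW.
  move: cl; rewrite /series/= /geometric.
  by under eq_fun do under eq_bigr do rewrite mul1r.
have msum : measurable_fun [set: T] (fun x => \sum_(k <oo) (v k x)%:E).
  by apply: ge0_emeasurable_sum => // k x _ _; rewrite lee_fin.
have isum : P.-integrable [set: T] (fun x => \sum_(k <oo) (v k x)%:E).
  apply/integrableP; split => //.
  apply: le_lt_trans sumv; rewrite le_eqVlt; apply/orP; left; apply/eqP.
  by apply: eq_integral => x _; rewrite gee0_abs// nneseries_ge0// => k _ _;
    rewrite lee_fin.
have := integrable_ae measurableT isum.
apply: filterS => x /(_ I) xfin.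
have cv : cvgn (series (fun k => v k x)).
  apply: nondecreasing_is_cvgn.
    by apply/nondecreasing_seqP => n; rewrite /series/= big_nat_recr//= lerDl.
  exists (fine (\sum_(k <oo) (v k x)%:E)) => _ [n _ <-].
  rewrite -lee_fin fineK//= -sumEFin.
  by apply: nneseries_lim_ge => k _; rewrite lee_fin.
have /normed_cvg : cvgn [normed series (fun k => u k.+1 x - u k x)%R].
  exact: cv.
have -> : series (fun k => u k.+1 x - u k x)%R = (fun n => u n x - u 0%N x)%R.
  by apply/funext => n; rewrite /series/= telescope_sumr.
move=> c.
have -> : u ^~ x = (fun n => (u n x - u 0%N x) + u 0%N x)%R.
  by apply/funext => n; rewrite subrK.
by apply: is_cvgD => //; exact: is_cvg_cst.
Qed.

Lemma integrable_expRN {d} {T : measurableType d} {R : realType}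
    (P : probability T R) (f : T -> R) :
  measurable_fun [set: T] f -> (forall x, (0 <= f x)%R) ->
  P.-integrable [set: T] (EFin \o (fun x => expR (- f x))).
Proof.
move=> mf f0; apply: measurable_bounded_integrable => //.
- exact: fin_num_fun_lty.
- apply: measurableT_comp => //; exact: measurableT_comp.
- exists 1%R; split=> // M M1 x _.
  rewrite /= ger0_norm ?expR_ge0// (le_trans _ (ltW M1))//.
  by rewrite -[leRHS]expR0 ler_expR oppr_le0.
Qed.

(** If the exponentials have a positive limit, take logarithms. A zero limit would force [a] to +oo,
    against the finite lower limit. *)
Lemma cvgn_of_cvgn_expRN {R : realType} (a : nat -> R) :
  cvgn (fun k => expR (- a k / 2)) ->
  limn_einf (EFin \o a) < +oo -> cvgn a.
Proof.
move=> /cvg_ex[l ul] afin.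
have l0 : (0 <= l)%R.
  apply: (cvgr_to_ge ul).
  by apply: nearW => k; exact: expR_ge0.
move: l0; rewrite le_eqVlt => /predU1P[l0|l0].
- suff : EFin \o a @ \oo --> +oo by move=> /cvg_limn_einf_sup[E _]; rewrite E in afin.
  apply/cvgeryP/cvgryPge => A.
  have : \forall k \near \oo, (expR (- a k / 2) < expR (- A / 2))%R.
    by apply: (cvgr_lt _ ul); rewrite -l0 expR_gt0.
  by apply: filterS => k; rewrite ltr_expR; lra.
- apply/cvg_ex; exists (- (2 * ln l))%R.
  rewrite (_ : a = fun k => - (2 * ln (expR (- a k / 2))))%R; last first.
    by apply/funext => k; rewrite expRK; field.
  apply: cvgN; apply: cvgMr.
  by apply: continuous_cvg => //; exact: continuous_ln.
Qed.

Lemma measurable_fun_limn_einf {d} {T : measurableType d} {R : realType}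
    (D : set T) (f : nat -> T -> \bar R) :
  (forall n, measurable_fun D (f n)) ->
  measurable_fun D (fun x => limn_einf (f ^~ x)).
Proof.
move=> mf; rewrite (_ : (fun x => _) = fun x => - limn_esup (-%E \o f ^~ x)).
  apply: measurableT_comp => //; apply: measurable_fun_limn_esup => k.
  exact: measurableT_comp.
apply/funext => x; rewrite -limn_einfN; congr limn_einf.
by apply/funext => k /=; rewrite oppeK.
Qed.

(** Strict convexity of [exp(-x)] turns near minimality of [phi] into convergence, and the common
    bound [C] on the means keeps the limit finite. *)
Lemma exists_ae_cvgn_convex {d} {T : measurableType d} {R : realType}
    (P : probability T R) (D : nat -> set (T -> R)) (C : R) :
  (forall m n, (m <= n)%N -> D n `<=` D m) ->
  (forall n, D n !=set0) ->
  (forall n f g, D n f -> D n g -> D n (fun x => (f x + g x) / 2)%R) ->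
  (forall n f, D n f -> measurable_fun [set: T] f) ->
  (forall n f, D n f -> forall x, (0 <= f x)%R) ->
  (forall n f, D n f -> \int[P]_x (f x)%:E <= C%:E) ->
  exists (h : nat -> T -> R) (h0 : T -> R),
    [/\ forall k, D k (h k), measurable_fun [set: T] h0,
        forall x, (0 <= h0 x)%R &
        {ae P, forall x, h ^~ x @ \oo --> h0 x}].
Proof.
move=> Dnd Dne Dmid Dm D0 DC.
pose phi f := (\int[P]_x expR (- f x))%R.
have iexp n f : D n f -> P.-integrable [set: T] (EFin \o (fun x => expR (- f x))).
  by move=> Df; apply: integrable_expRN; [exact: Dm Df|exact: D0 Df].
have phi01 f : D 0%N f -> (0 <= phi f <= 1)%R.
  move=> Df; apply/andP; split; first by apply: Rintegral_ge0 => x _; exact: expR_ge0.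
  have -> : 1%R = (\int[P]_(x in [set: T]) 1)%R :> R.
    by rewrite Rintegral_cst//= [P _]probability_setT mul1r.
  apply: le_Rintegral => //; first exact: iexp Df.
    exact: finite_measure_integrable_cst.
  by move=> x _; rewrite -[leRHS]expR0 ler_expR oppr_le0; exact: D0 Df x.
(* The squared increment of [u] integrates to twice the midpoint gap of [phi], so to at most
   [4 * delta k]; this is [4^-1 ^+ k], as the fast L^2 criterion requires. *)
pose delta k : R := (4^-1 ^+ k / 4)%R.
have delta0 k : (0 < delta k)%R by rewrite divr_gt0// exprn_gt0// invr_gt0.
have delta_nd k : (delta k.+1 <= delta k)%R.
  by move: (delta0 k); rewrite /delta exprS; lra.
have [h hP] := near_minimizing_seq _ _ _ _ Dnd Dne Dmid phi01 delta0 delta_nd.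
have Dh k : D k (h k) by case: (hP k).
have mh k : measurable_fun [set: T] (h k) by exact: Dm (Dh k).
pose u k x := expR (- h k x / 2).
have mu_ k : measurable_fun [set: T] (u k).
  apply: measurableT_comp => //; apply: measurable_funM => //.
  exact: measurableT_comp.
have hu k : \int[P]_x ((u k.+1 x - u k x) ^+ 2)%:E <= (4^-1 ^+ k)%:E.
  pose m := (fun x => (h k x + h k.+1 x) / 2)%R.
  have Dm' : D k m by apply: Dmid => //; exact: (Dnd _ _ (leqnSn k)).
  have i1 := iexp _ _ (Dh k); have i2 := iexp _ _ (Dh k.+1).
  have i3 := iexp _ _ Dm'.
  have E x : ((u k.+1 x - u k x) ^+ 2)%:E =
      ((expR (- h k x) + expR (- h k.+1 x)) - 2 * expR (- m x))%:E.
    congr EFin.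
    have eu j : expR (- h j x) = (u j x ^+ 2)%R.
      by rewrite -expRM_natl; congr expR; field.
    rewrite !eu (_ : expR (- m x) = u k x * u k.+1 x)%R; first by ring.
    by rewrite -expRD; congr expR; rewrite /m; field.
  have phiE n f : D n f -> \int[P]_x (expR (- f x))%:E = (phi f)%:E.
    by move=> Df; rewrite /phi /Rintegral fineK// integrable_fin_num//; exact: iexp Df.
  under eq_integral do rewrite E EFinB EFinD EFinM.
  rewrite integralB//; last 2 first.
  - exact: integrableD.
  - exact: integrableZl.
  rewrite integralD// integralZl// (phiE _ _ (Dh k)) (phiE _ _ (Dh k.+1)) (phiE _ _ Dm').
  rewrite -EFinM -[X in X - _]EFinD -EFinB lee_fin.
  have [_] := hP k; rewrite -/m /delta; lra.
have ucvg := ae_cvgn_L2_fast _ _ mu_ hu.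
pose li x := limn_einf (fun k => (h k x)%:E).
pose ls x := limn_esup (fun k => (h k x)%:E).
have mls : measurable_fun [set: T] ls.
  by apply: measurable_fun_limn_esup => k; exact/measurable_EFinP.
have mli : measurable_fun [set: T] li.
  by apply: measurable_fun_limn_einf => k; exact/measurable_EFinP.
have li0 x : 0 <= li x.
  rewrite /li limn_einf_lim; apply: lime_ge; first exact: is_cvg_einfs.
  apply: nearW => n; apply: le_ereal_inf_tmp => _ [k _ <-].
  by rewrite lee_fin; exact: D0 (Dh k) x.
(* Fatou bounds the mean of the lower limit by [C], so the lower limit is finite almost everywhere
   and [h] cannot escape to +oo. *)
have liint : P.-integrable [set: T] li.
  apply/integrableP; split => //.
  rewrite (eq_integral li); last by move=> x _; rewrite gee0_abs.
  apply: (@le_lt_trans _ _ C%:E); last exact: ltry.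
  apply: le_trans (fatou _ _ _ _) _ => //.
  - by move=> k; exact/measurable_EFinP.
  - by move=> k x _; rewrite lee_fin; exact: D0 (Dh k) x.
  rewrite limn_einf_lim; apply: lime_le; first exact: is_cvg_einfs.
  apply: nearW => n; apply: ereal_inf_le.
  exists (\int[P]_x (h n x)%:E); last exact: DC (Dh n).
  by exists n => /=.
(* The upper limit is measurable; [fine] and the maximum with 0 make it real and nonnegative also on
   the exceptional null set. *)
exists h, (fun x => Num.max 0%R (fine (ls x))); split => //.
- by apply: measurable_maxr => //; exact: measurableT_comp.
- by move=> x; rewrite le_max lexx.
have lifin := integrable_ae measurableT liint.
apply: filterS2 ucvg lifin => x ux /(_ I) lix.
have /cvg_ex[l hl] : cvgn (h ^~ x).
  by apply: cvgn_of_cvgn_expRN => //; rewrite -[limn_einf _]/(li x) ltey_eq lix.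
have l0 : (0 <= l)%R.
  by apply: (cvgr_to_ge hl); apply: nearW => k; exact: D0 (Dh k) x.
have [_ ->] : (limn_einf (EFin \o h ^~ x) = l%:E) * (ls x = l%:E).
  by apply: cvg_limn_einf_sup; apply: cvg_EFin => //; exact: nearW.
by rewrite /= max_r.
Qed.

(** * Almost sure inequalities and integrals over events *)

Lemma ae_null_dominates {d} {T : measurableType d} {R : realType}
    (P Q : probability T R) (p : T -> Prop) :
  P `<< Q -> {ae Q, forall x, p x} -> {ae P, forall x, p x}.
Proof.
by move=> /null_content_dominatesP PQ [N [mN QN pN]]; exists N; split => //; exact: PQ.
Qed.

Lemma ae_probability1 {d} {T : measurableType d} {R : realType}
    (P : probability T R) (A : set T) :
  measurable A -> P A = 1 <-> {ae P, forall x, A x}.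
Proof.
move=> mA; have mAC := measurableC mA; split => [PA|/(negligibleP _ mAC)].
  by apply/(negligibleP _ mAC); have := probability_setC P mA; rewrite PA subee.
move=> PAC0; have PAC : P (~` A) = 0 by exact: PAC0.
have := probability_setC P mA; rewrite PAC.
have : P A \is a fin_num by exact: fin_num_measure.
case: (P A) => // r _ /esym/eqP; rewrite -EFinB eqe subr_eq0 => /eqP <-.
by [].
Qed.

Lemma gmeasurable_measurable_fun {d} {T : measurableType d} {R : realType}
    (G : set (set T)) (X : T -> R) :
  G `<=` measurable -> gmeasurable G X -> measurable_fun [set: T] X.
Proof. by move=> Gm GX _ B mB; rewrite setTI; apply: Gm; exact: GX. Qed.

Lemma gmeasurable_ltr {d} {T : measurableType d} {R : realType}
    (G : set (set T)) (X Y : T -> R) :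
  sigma_algebra [set: T] G -> gmeasurable G X -> gmeasurable G Y ->
  G [set x | X x < Y x]%R.
Proof.
move=> sG GX GY.
have GE : measurable = G :> set (set (g_sigma_algebraType G)).
  exact: measurable_g_measurableTypeE.
have mG (Z : g_sigma_algebraType G -> R) : gmeasurable G Z ->
    measurable_fun [set: g_sigma_algebraType G] Z.
  by move=> GZ _ B mB; rewrite setTI GE; exact: GZ.
have /(_ measurableT [set true] I) := measurable_fun_ltr (mG _ GX) (mG _ GY).
by rewrite setTI GE.
Qed.

Lemma ae_le_integral {d} {T : measurableType d} {R : realType}
    (P : probability T R) (A : set T) (X Y : T -> R) :
  measurable A -> P.-integrable [set: T] (EFin \o X) ->
  P.-integrable [set: T] (EFin \o Y) -> {ae P, forall x, (X x <= Y x)%R} ->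
  \int[P]_(x in A) (X x)%:E <= \int[P]_(x in A) (Y x)%:E.
Proof.
move=> mA iX iY XY.
have iXA := integrableS measurableT mA (@subsetT _ _) iX.
have iYA := integrableS measurableT mA (@subsetT _ _) iY.
rewrite -sube_ge0; last by rewrite integrable_fin_num.
rewrite -integralB_EFin//.
have mYX : measurable_fun A (fun x => (Y x - X x)%R).
  apply/measurable_EFinP; rewrite (_ : EFin \o _ = (EFin \o Y) \- (EFin \o X))//.
  by apply: emeasurable_funB; [exact: measurable_int iYA|exact: measurable_int iXA].
(* The difference is replaced by its positive part, equal to it almost everywhere and nonnegative at
   every point. *)
rewrite (@ae_eq_integral _ _ _ P A (fun x => (Num.max 0 (Y x - X x))%:E))//.
- by apply: integral_ge0 => x _; rewrite lee_fin le_max lexx.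
- exact/measurable_EFinP.
- by apply/measurable_EFinP; exact: measurable_maxr.
- by apply: filterS XY => x XYx _; rewrite max_r// subr_ge0.
Qed.

(** The event [B] where [Y < X] belongs to [G]. Testing the hypothesis on it shows that [X - Y],
    positive on [B], has integral 0 there, so [B] is null. *)
Lemma ae_le_of_integral_le {d} {T : measurableType d} {R : realType}
    (P : probability T R) (G : set (set T)) (X Y : T -> R) :
  sigma_algebra [set: T] G -> G `<=` measurable ->
  gmeasurable G X -> gmeasurable G Y ->
  P.-integrable [set: T] (EFin \o X) -> P.-integrable [set: T] (EFin \o Y) ->
  (forall A, G A ->
     \int[P]_(x in A) (X x)%:E <= \int[P]_(x in A) (Y x)%:E) ->
  {ae P, forall x, (X x <= Y x)%R}.
Proof.
move=> sG Gm GX GY iX iY XY.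
pose B := [set x | Y x < X x]%R.
have GB : G B by exact: gmeasurable_ltr.
have mB := Gm _ GB.
have iXB := integrableS measurableT mB (@subsetT _ _) iX.
have iYB := integrableS measurableT mB (@subsetT _ _) iY.
have mXY : measurable_fun B (fun x => (X x - Y x)%:E).
  rewrite (_ : (fun x => _) = (EFin \o X) \- (EFin \o Y))//.
  by apply: emeasurable_funB; [exact: measurable_int iXB|exact: measurable_int iYB].
have /ae_eq_integral_abs : \int[P]_(x in B) `|(X x - Y x)%:E| = 0.
  rewrite (eq_integral (fun x => (X x - Y x)%:E)); last first.
    by move=> x /set_mem YX; rewrite gee0_abs// lee_fin subr_ge0 ltW.
  apply/eqP; rewrite eq_le integral_ge0 ?andbT; last first.
    by move=> x YX; rewrite lee_fin subr_ge0 ltW.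
  rewrite integralB_EFin// sube_le0 XY//.
move=> /(_ mB mXY) XY0.
apply: filterS XY0 => x; rewrite leNgt => XYx; apply/negP => YX.
by move: (XYx YX) => -[] /eqP; rewrite subr_eq0 gt_eqF.
Qed.

Lemma expectationE {d} {T : measurableType d} {R : realType}
    (P : probability T R) (X : T -> R) : 'E_P[X] = \int[P]_x (X x)%:E.
Proof. by rewrite unlock. Qed.

(** * Hedges and superhedging prices *)

(** Here [eta] plays the role of [alpha * xi] with [xi] in [A0 M]. Testing on events of [G] instead
    of using a conditional expectation makes the condition affine in [eta] and suited to limits of
    integrals. *)
Definition is_hedge {d} {T : measurableType d} {R : realType}
    (M : set (probability T R)) (G : set (set T)) (fN : T -> R)
    (alpha : R) (eta : T -> R) : Prop :=
  [/\ forall x, (0 <= eta x)%R,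
      forall P, M P -> P.-integrable [set: T] (EFin \o eta),
      forall P, M P -> \int[P]_x (eta x)%:E = alpha%:E &
      forall P, M P -> forall A, G A ->
        \int[P]_(x in A) (fN x)%:E <= \int[P]_(x in A) (eta x)%:E].

Lemma is_hedge_superhedged {d} {T : measurableType d} {R : realType}
    (M : set (probability T R)) (G : set (set T)) (fN : T -> R)
    (alpha : R) (xi : T -> R) :
  sigma_algebra [set: T] G -> G `<=` measurable -> gmeasurable G fN ->
  (forall P, M P -> P.-integrable [set: T] (EFin \o fN)) ->
  (0 <= alpha)%R -> A0 M xi -> superhedged M G fN alpha xi ->
  is_hedge M G fN alpha (fun x => alpha * xi x)%R.
Proof.
move=> sG Gm GfN ifN alpha0 [xi0 ixi Exi] hxi; split.
- by move=> x; rewrite mulr_ge0.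
- move=> P MP; rewrite (_ : EFin \o _ = (fun x => alpha%:E * (EFin \o xi) x))//.
  by apply: integrableZl => //; exact: ixi.
- move=> P MP; under eq_integral do rewrite EFinM.
  rewrite (integralZl measurableT (ixi _ MP)).
  by have := Exi _ MP; rewrite expectationE => ->; rewrite mule1.
- move=> P MP A GA; have mA := Gm _ GA.
  have [GY iY EY] := is_cond_exp_cond_exp P G xi sG Gm (ixi _ MP).
  set Y := cond_exp P G xi in GY iY EY.
  have iaY : P.-integrable [set: T] (EFin \o (fun x => alpha * Y x)%R).
    rewrite (_ : EFin \o _ = (fun x => alpha%:E * (EFin \o Y) x))//.
    exact: integrableZl.
  have mY := gmeasurable_measurable_fun _ _ Gm GY.
  have mfN := gmeasurable_measurable_fun _ _ Gm GfN.
  apply: (@le_trans _ _ (\int[P]_(x in A) (alpha * Y x)%:E)).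
    apply: ae_le_integral => //; first exact: ifN.
    have mS : measurable [set x | (fN x - alpha * Y x <= 0)%R].
      rewrite -[X in measurable X]setTI; apply: measurable_fun_le => //.
      by apply: measurable_funB => //; exact: measurable_funM.
    have /(ae_probability1 P _ mS) := hxi _ MP.
    by apply: filterS => x /=; rewrite subr_le0.
  under eq_integral do rewrite EFinM.
  under [leRHS]eq_integral do rewrite EFinM.
  rewrite (integralZl mA (integrableS measurableT mA (@subsetT _ _) iY)).
  rewrite (integralZl mA (integrableS measurableT mA (@subsetT _ _) (ixi _ MP))).
  by rewrite [X in alpha%:E * X <= _](EY _ GA).
Qed.

Lemma superhedged_is_hedge {d} {T : measurableType d} {R : realType}
    (M : set (probability T R)) (G : set (set T)) (fN : T -> R)
    (alpha : R) (xi0 eta : T -> R) :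
  sigma_algebra [set: T] G -> G `<=` measurable -> gmeasurable G fN ->
  (forall P, M P -> P.-integrable [set: T] (EFin \o fN)) ->
  (0 <= alpha)%R -> A0 M xi0 -> is_hedge M G fN alpha eta ->
  exists2 xi, A0 M xi & superhedged M G fN alpha xi.
Proof.
move=> sG Gm GfN ifN alpha0 hxi0 [eta0 ieta Eeta heta].
(* Both [fN] and [alpha * E[xi | G]] are [G]-measurable, so inequalities between integrals over [G]
   yield the almost sure one. *)
suff [xi hxi Hxi] : exists2 xi, A0 M xi & forall P, M P -> forall A, G A ->
    \int[P]_(x in A) (fN x)%:E <= alpha%:E * \int[P]_(x in A) (xi x)%:E.
  exists xi => // P MP; have [_ ixi _] := hxi.
  have [GY iY EY] := is_cond_exp_cond_exp P G xi sG Gm (ixi _ MP).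
  set Y := cond_exp P G xi in GY iY EY *.
  have mY := gmeasurable_measurable_fun _ _ Gm GY.
  have mfN := gmeasurable_measurable_fun _ _ Gm GfN.
  have mS : measurable [set x | (fN x - alpha * Y x <= 0)%R].
    rewrite -[X in measurable X]setTI; apply: measurable_fun_le => //.
    by apply: measurable_funB => //; exact: measurable_funM.
  apply/(ae_probability1 P _ mS).
  have : {ae P, forall x, (fN x <= alpha * Y x)%R}.
    apply: (ae_le_of_integral_le P G) => //.
    - move=> B mB.
      have : measurable_fun [set: R] (fun y : R => alpha * y)%R.
        exact: measurable_funM.
      by move=> /(_ measurableT B mB); rewrite setTI => /GY.
    - exact: ifN.
    - rewrite (_ : EFin \o _ = (fun x => alpha%:E * (EFin \o Y) x))//.
      exact: integrableZl.
    - move=> A GA; have mA := Gm _ GA; apply: (le_trans (Hxi P MP A GA)).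
      under [leRHS]eq_integral do rewrite EFinM.
      rewrite (integralZl mA (integrableS measurableT mA (@subsetT _ _) iY)).
      by rewrite [X in _ <= alpha%:E * X](EY _ GA).
  by apply: filterS => x /=; rewrite subr_le0.
(* At price 0 one cannot divide by [alpha]. There [eta] has mean 0, so the integrals of [fN] over
   [G] are at most 0 and [xi0] serves. *)
move: alpha0; rewrite le_eqVlt => /predU1P[alpha0|alpha0].
  exists xi0 => // P MP A GA; have mA := Gm _ GA.
  apply: (le_trans (heta P MP A GA)); rewrite -alpha0 mul0e.
  have -> : 0 = \int[P]_x (eta x)%:E by rewrite Eeta// -alpha0.
  apply: ge0_subset_integral => //; last by move=> x _; rewrite lee_fin.
  exact: measurable_int (ieta _ MP).
have Z P (iP : M P) A : measurable A ->
    \int[P]_(x in A) (alpha^-1 * eta x)%:E = alpha^-1%:E * \int[P]_(x in A) (eta x)%:E.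
  move=> mA; under eq_integral do rewrite EFinM.
  by rewrite (integralZl mA (integrableS measurableT mA (@subsetT _ _) (ieta _ iP))).
exists (fun x => alpha^-1 * eta x)%R; first split.
- by move=> x; rewrite mulr_ge0// invr_ge0 ltW.
- move=> P MP; rewrite (_ : EFin \o _ = (fun x => alpha^-1%:E * (EFin \o eta) x))//.
  by apply: integrableZl => //; exact: ieta.
- by move=> P MP; rewrite expectationE Z// Eeta// -EFinM mulVf// gt_eqF.
- move=> P MP A GA; rewrite Z ?muleA -?EFinM ?divff ?gt_eqF ?mul1e//; last exact: Gm.
  exact: heta.
Qed.

Lemma is_hedge_mid {d} {T : measurableType d} {R : realType}
    (M : set (probability T R)) (G : set (set T)) (fN : T -> R)
    (a b : R) (eta zeta : T -> R) :
  G `<=` measurable ->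
  is_hedge M G fN a eta -> is_hedge M G fN b zeta ->
  is_hedge M G fN ((a + b) / 2)%R (fun x => (eta x + zeta x) / 2)%R.
Proof.
move=> Gm [eta0 ieta Eeta heta] [zeta0 izeta Ezeta hzeta].
have Z P (iP : M P) A : measurable A ->
    \int[P]_(x in A) ((eta x + zeta x) / 2)%:E =
    2^-1%:E * (\int[P]_(x in A) (eta x)%:E + \int[P]_(x in A) (zeta x)%:E).
  move=> mA; under eq_integral do rewrite mulrC EFinM EFinD.
  have i1 := integrableS measurableT mA (@subsetT _ _) (ieta _ iP).
  have i2 := integrableS measurableT mA (@subsetT _ _) (izeta _ iP).
  by rewrite (integralZl mA (integrableD mA i1 i2)) integralD.
split.
- by move=> x; rewrite divr_ge0// addr_ge0.
- move=> P MP.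
  rewrite (_ : EFin \o _ = (fun x => 2^-1%:E * ((EFin \o eta) \+ (EFin \o zeta)) x)).
    apply: integrableZl => //; apply: integrableD => //; [exact: ieta|exact: izeta].
  by apply/funext => x /=; rewrite mulrC EFinM EFinD.
- by move=> P MP; rewrite Z// Eeta// Ezeta// -EFinD -EFinM; congr EFin; field.
- move=> P MP A GA; have mA := Gm _ GA; rewrite Z//.
  have := heta P MP A GA; have := hzeta P MP A GA.
  have fin1 : \int[P]_(x in A) (eta x)%:E \is a fin_num.
    by apply: integrable_fin_num => //; exact: integrableS (ieta _ MP).
  have fin2 : \int[P]_(x in A) (zeta x)%:E \is a fin_num.
    by apply: integrable_fin_num => //; exact: integrableS (izeta _ MP).
  rewrite -(fineK fin1) -(fineK fin2).
  (* No integrability of [fN] is assumed here; the value +oo contradicts the finite bound in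
     [h1]. *)
  case: (\int[P]_(x in A) (fN x)%:E) => [r| |] h1 h2.
  + by move: h1 h2; rewrite -EFinD -EFinM !lee_fin; lra.
  + by move: h1; rewrite leye_eq.
  + by rewrite leNye.
Qed.

(** * Uniform integrability and limits of hedges *)

Lemma uniformly_integrable_bound {d} {T : measurableType d} {R : realType}
    (P : probability T R) (S : set (T -> R)) (e : R) :
  uniformly_integrable P S -> (0 < e)%R ->
  exists2 c : R, (0 <= c)%R & forall xi, S xi ->
    \int[P]_(x in [set x | (c < `|xi x|)%R]) (`|xi x|%R)%:E <= e%:E.
Proof.
move=> US e0.
have e0' : 0 < e%:E by rewrite lte_fin.
have near_e : \forall c \near +oo%R,
    ereal_sup [set \int[P]_(x in [set x | (c < `|xi x|)%R]) (`|xi x|%R)%:E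
              | xi in S] < e%:E.
  exact: (US _ (open_ereal_lt' e0')).
have near_0 : \forall c \near +oo%R, (0 <= c :> R)%R.
  by apply: nbhs_pinfty_ge; exact: num_real.
have [c [ce c0]] := filter_ex (filterI near_e near_0).
exists c => // xi Sxi; apply: le_trans (ltW ce).
by apply: ereal_sup_ubound; exists xi.
Qed.

(** Uniform integrability of [A0 M] passes to all hedges of price at most [alpha0]. Since
    [eta <= (alpha0 + 1) * xi], the excess of [eta] over [(alpha0 + 1) * c] is at most
    [(alpha0 + 1) * xi] and vanishes unless [xi > c]. *)
Lemma is_hedge_tail {d} {T : measurableType d} {R : realType}
    (M : set (probability T R)) (P : probability T R) (alpha0 e : R)
    (xi0 : T -> R) :
  M P -> uniformly_integrable P (A0 M) -> A0 M xi0 -> (0 <= alpha0)%R ->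
  (0 < e)%R ->
  exists2 c : R, (0 <= c)%R &
    forall G fN alpha eta, is_hedge M G fN alpha eta -> (alpha <= alpha0)%R ->
      \int[P]_x (Num.max 0 (eta x - c))%:E <= e%:E.
Proof.
move=> MP UI [xi00 ixi0 Exi0] alpha00 e0.
(* The 1 keeps the normalizing divisor positive when [alpha0 = 0]. *)
have C0 : (0 < alpha0 + 1)%R by rewrite ltr_wpDl.
have [c c0 hc] := uniformly_integrable_bound _ _ _ UI (divr_gt0 e0 C0).
exists ((alpha0 + 1) * c)%R; first by rewrite mulr_ge0// ltW.
move=> G fN alpha eta [eta0 ieta Eeta _] aa0.
(* Adding a multiple of [xi0] brings the mean up to [alpha0 + 1], which
   dominates [eta] by a fixed multiple of an element of [A0 M]. *)
pose b := (alpha0 + 1 - alpha)%R.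
have b0 : (0 <= b)%R by rewrite /b; lra.
pose xi x := ((alpha0 + 1)^-1 * (eta x + b * xi0 x))%R.
have xiE x : (xi x)%:E =
    (alpha0 + 1)^-1%:E * ((eta x)%:E + b%:E * (xi0 x)%:E).
  by rewrite /xi EFinM EFinD EFinM.
have ib Q : M Q -> Q.-integrable [set: T] (fun x => b%:E * (xi0 x)%:E).
  by move=> MQ; apply: (integrableZl measurableT); exact: ixi0.
have ib' Q : M Q -> Q.-integrable [set: T] (fun x => (eta x)%:E + b%:E * (xi0 x)%:E).
  by move=> MQ; apply: (integrableD measurableT); [exact: ieta|exact: ib].
have A0xi : A0 M xi.
  split.
  - move=> x; rewrite /xi mulr_ge0 ?invr_ge0 ?(ltW C0)// addr_ge0//.
    by rewrite mulr_ge0.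
  - move=> Q MQ; rewrite (_ : EFin \o xi = fun x => (alpha0 + 1)^-1%:E *
        ((eta x)%:E + b%:E * (xi0 x)%:E)); last by apply/funext => x; exact: xiE.
    by apply: (integrableZl measurableT); exact: ib'.
  - move=> Q MQ; rewrite expectationE.
    under eq_integral do rewrite xiE.
    rewrite (integralZl measurableT (ib' _ MQ)).
    rewrite (integralD measurableT (ieta _ MQ) (ib _ MQ)).
    rewrite (integralZl measurableT (ixi0 _ MQ)) [X in X + _](Eeta _ MQ).
    have := Exi0 _ MQ; rewrite expectationE => ->.
    rewrite mule1 -EFinD -EFinM; congr EFin; rewrite /b; field.
    by rewrite gt_eqF.
have [xi_ge0 ixi _] := A0xi.
have mxi : measurable_fun [set: T] xi.
  by apply/measurable_EFinP; exact: measurable_int (ixi _ MP).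
have meta : measurable_fun [set: T] eta.
  by apply/measurable_EFinP; exact: measurable_int (ieta _ MP).
pose S := [set x | (c < `|xi x|)%R].
have mnxi : measurable_fun [set: T] (fun x => `|xi x|%R).
  exact: measurableT_comp.
have mS : measurable S.
  have /(_ measurableT [set true] I) := measurable_fun_ltr (measurable_cst c) mnxi.
  by rewrite setTI.
apply: (@le_trans _ _ (\int[P]_(x in S) ((alpha0 + 1)%:E * (`|xi x|%R)%:E))).
  rewrite [leRHS]integral_mkcond; apply: ge0_le_integral => //.
  - by move=> x _; rewrite lee_fin le_max lexx.
  - apply/measurable_EFinP; apply: measurable_maxr => //.
    exact: measurable_funB.
  - apply/measurable_restrict => //; rewrite setTI.
    by apply: measurable_funTS; apply: measurable_funeM; exact/measurable_EFinP.
  - move=> x _; rewrite patchE.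
    have etax : (eta x <= (alpha0 + 1) * xi x)%R.
      rewrite /xi mulrA divff ?gt_eqF// mul1r lerDl mulr_ge0//.
    case: ifPn => [/set_mem xS|/negP xS].
      rewrite -EFinM lee_fin ge_max mulr_ge0 ?(ltW C0)//= ger0_norm//.
      by apply: (le_trans _ etax); rewrite gerBl mulr_ge0// ltW.
    have : (`|xi x| <= c)%R by rewrite leNgt; apply/negP => h; apply: xS; exact: mem_set.
    rewrite ger0_norm// => xic.
    rewrite lee_fin ge_max lexx/= subr_le0 (le_trans etax)//.
    by rewrite ler_pM2l.
rewrite ge0_integralZl_EFin//; last 2 first.
- by apply: measurable_funTS; exact/measurable_EFinP.
- exact: ltW.
apply: (@le_trans _ _ ((alpha0 + 1)%:E * (e / (alpha0 + 1))%:E)).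
  by rewrite lee_pmul2l// ?lte_fin//; exact: hc.
by rewrite -EFinM lee_fin mulrC divfK// gt_eqF.
Qed.

Lemma ae_fatou {d} {T : measurableType d} {R : realType}
    (P : probability T R) (h : nat -> T -> R) (h0 : T -> R) (l : \bar R) :
  (forall k, measurable_fun [set: T] (h k)) -> measurable_fun [set: T] h0 ->
  (forall k x, (0 <= h k x)%R) -> (forall x, (0 <= h0 x)%R) ->
  {ae P, forall x, h ^~ x @ \oo --> h0 x} ->
  \int[P]_x (h k x)%:E @[k --> \oo] --> l ->
  \int[P]_x (h0 x)%:E <= l.
Proof.
move=> mh mh0 hge0 h0ge0 hh0 hl.
have mEh k : measurable_fun [set: T] (fun x => (h k x)%:E) by exact/measurable_EFinP.
have [<- _] := cvg_limn_einf_sup hl.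
apply: (@le_trans _ _ (\int[P]_x limn_einf (fun k => (h k x)%:E))).
  apply: ae_ge0_le_integral => //.
  - by move=> x _; rewrite lee_fin.
  - exact/measurable_EFinP.
  - move=> x _; rewrite limn_einf_lim; apply: lime_ge; first exact: is_cvg_einfs.
    by apply: nearW => n; apply: le_ereal_inf_tmp => _ [k _ <-]; rewrite lee_fin.
  - exact: measurable_fun_limn_einf.
  apply: filterS hh0 => x hx _.
  have [-> _] : (limn_einf (EFin \o h ^~ x) = (h0 x)%:E) *
      (limn_esup (EFin \o h ^~ x) = (h0 x)%:E).
    by apply: cvg_limn_einf_sup; apply: cvg_EFin => //; exact: nearW.
  exact: lexx.
by apply: fatou => // k x _; rewrite lee_fin.
Qed.

(** Each [h k] splits into its truncation at [c] and its excess over [c]. The excess costs at most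
    [e] uniformly in [k]; the truncations converge by dominated convergence, to a limit below
    [h0]. *)
Lemma le_integral_uniform_tail {d} {T : measurableType d} {R : realType}
    (P : probability T R) (h : nat -> T -> R) (h0 : T -> R) (A : set T)
    (a : \bar R) :
  (forall k, measurable_fun [set: T] (h k)) -> measurable_fun [set: T] h0 ->
  (forall k x, (0 <= h k x)%R) -> (forall x, (0 <= h0 x)%R) ->
  {ae P, forall x, h ^~ x @ \oo --> h0 x} ->
  (forall e : R, (0 < e)%R -> exists2 c : R, (0 <= c)%R &
     forall k, \int[P]_x (Num.max 0 (h k x - c))%:E <= e%:E) ->
  measurable A -> (forall k, a <= \int[P]_(x in A) (h k x)%:E) ->
  a <= \int[P]_(x in A) (h0 x)%:E.
Proof.
move=> mh mh0 hge0 h0ge0 hh0 tail mA ah.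
apply/lee_addgt0Pr => e /tail[c c0 hc].
have mmin (f : T -> R) : measurable_fun [set: T] f ->
    measurable_fun A (fun x => (Num.min (f x) c)%:E).
  move=> mf; apply: measurable_funTS; apply/measurable_EFinP.
  exact: measurable_minr.
have min0 (f : T -> R) x : (0 <= f x)%R -> (0 <= Num.min (f x) c)%R.
  by move=> f0; rewrite le_min f0.
have [_ _ cvgm] : [/\ P.-integrable A (fun x => (Num.min (h0 x) c)%:E),
    [sequence \int[P]_(x in A) `|(Num.min (h k x) c)%:E - (Num.min (h0 x) c)%:E|]_k @ \oo --> 0
  & [sequence \int[P]_(x in A) (Num.min (h k x) c)%:E]_k @ \oo -->
      \int[P]_(x in A) (Num.min (h0 x) c)%:E].
  apply: (@dominated_convergence _ _ _ P A mA _ _ (cst c%:E)).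
  - by move=> k; exact: mmin.
  - exact: mmin.
  - apply: filterS hh0 => x hx _; apply: cvg_EFin; first exact: nearW.
    (* Writing the minimum through an absolute value reduces its convergence to continuity of the
       norm. *)
    rewrite minr_absE; under eq_fun do rewrite minr_absE.
    apply: cvgMl; apply: cvgB; first by apply: cvgD => //; exact: cvg_cst.
    by apply: cvg_norm; apply: cvgB => //; exact: cvg_cst.
  - exact: finite_measure_integrable_cst.
  - apply: aeW => x k _; rewrite gee0_abs ?lee_fin ?min0//.
    by rewrite ge_min lexx orbT.
have step k : a <= \int[P]_(x in A) (Num.min (h k x) c)%:E + e%:E.
  have mmax : measurable_fun [set: T] (fun x => (Num.max 0 (h k x - c))%:E).
    apply/measurable_EFinP; apply: measurable_maxr => //.
    exact: measurable_funB.
  apply: (le_trans (ah k)).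
  rewrite (eq_integral (fun x => (Num.min (h k x) c)%:E +
      (Num.max 0 (h k x - c))%:E)); last first.
    move=> x _; rewrite -EFinD; congr EFin.
    have [hxc|hxc] := leP (h k x) c.
      by rewrite max_l ?addr0// subr_le0.
    by rewrite max_r ?subr_ge0 ?ltW// addrC subrK.
  rewrite ge0_integralD//; last 4 first.
  - by move=> x _; rewrite lee_fin min0.
  - exact: mmin.
  - by move=> x _; rewrite lee_fin le_max lexx.
  - exact: measurable_funTS.
  rewrite leeD2l//; apply: le_trans (hc k).
  apply: ge0_subset_integral => //.
  by move=> x _; rewrite lee_fin le_max lexx.
have : a <= \int[P]_(x in A) (Num.min (h0 x) c)%:E + e%:E.
  have cvgD : [sequence \int[P]_(x in A) (Num.min (h k x) c)%:E]_k n + e%:E @[n --> \oo] -->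
      \int[P]_(x in A) (Num.min (h0 x) c)%:E + e%:E.
    by apply: cvgeD => //; [exact: fin_num_adde_defl|exact: cvg_cst].
  rewrite -(cvg_lim _ cvgD)//; apply: lime_ge; last exact: nearW.
  by apply/cvg_ex; eexists; exact: cvgD.
move=> /le_trans; apply; rewrite leeD2r//.
apply: ge0_le_integral => //.
- by move=> x _; rewrite lee_fin min0.
- exact: mmin.
- by apply: measurable_funTS; exact/measurable_EFinP.
- by move=> x _; rewrite lee_fin ge_min lexx.
Qed.

(** Convergence is obtained under [P0] only and carried to every [P] in [M] by equivalence. The
    lower bounds on integrals over events then survive under each [P] separately. *)
Lemma is_hedge_limit {d} {T : measurableType d} {R : realType}
    (M : set (probability T R)) (P0 : probability T R) (G : set (set T))
    (fN : T -> R) (alpha0 f0 : R) (xi0 : T -> R) :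
  M P0 -> pairwise_equivalent M ->
  (forall P, M P -> uniformly_integrable P (A0 M)) ->
  G `<=` measurable -> A0 M xi0 -> (0 <= alpha0)%R ->
  (forall n : nat, exists alpha eta, [/\ (f0 <= alpha <= alpha0)%R,
     (alpha <= f0 + n.+1%:R^-1)%R & is_hedge M G fN alpha eta]) ->
  exists eta, is_hedge M G fN f0 eta.
Proof.
move=> MP0 eqM UI Gm hxi0 alpha00 hf0.
pose D n : set (T -> R) := [set eta | exists alpha, [/\ (f0 <= alpha <= alpha0)%R,
     (alpha <= f0 + n.+1%:R^-1)%R & is_hedge M G fN alpha eta]].
have D_m n eta : D n eta -> measurable_fun [set: T] eta.
  move=> [alpha [_ _ [_ ieta _ _]]].
  by apply/measurable_EFinP; exact: measurable_int (ieta _ MP0).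
have D_0 n eta : D n eta -> forall x, (0 <= eta x)%R by move=> [alpha [_ _ []]].
have [h [h0 [Dh mh0 h0ge0 hh0]]] : exists (h : nat -> T -> R) (h0 : T -> R),
    [/\ forall k, D k (h k), measurable_fun [set: T] h0,
        forall x, (0 <= h0 x)%R & {ae P0, forall x, h ^~ x @ \oo --> h0 x}].
  apply: (exists_ae_cvgn_convex P0 D alpha0) => //.
  - move=> m n mn eta [alpha [a1 a2 a3]]; exists alpha; split=> //.
    by rewrite (le_trans a2)// lerD2l lef_pV2 ?posrE// ler_nat.
  - by move=> n; have [alpha [eta ?]] := hf0 n; exists eta, alpha.
  - move=> n f g [a [/andP[a1 a2] a3 a4]] [b [/andP[b1 b2] b3 b4]].
    exists ((a + b) / 2)%R; split; last exact: is_hedge_mid.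
      by apply/andP; split; lra.
    by move: a3 b3; move: (f0 + _)%R => t a3 b3; lra.
  - move=> n f [a [/andP[_ a2] _ [_ _ Ef _]]].
    by rewrite Ef// lee_fin.
have [al /all_and3[al1 al2 hh]] := choice Dh.
have alcvg : (al k)%:E @[k --> \oo] --> f0%:E.
  apply: cvg_EFin; first exact: nearW.
  apply: (squeeze_cvgr (f := cst f0) (h := fun k => f0 + k.+1%:R^-1)%R).
  - by apply: nearW => k; rewrite al2 andbT; case/andP: (al1 k).
  - exact: cvg_cst.
  - rewrite -[X in _ --> X]addr0; apply: cvgD; first exact: cvg_cst.
    exact: cvg_harmonic.
have mh k : measurable_fun [set: T] (h k) by exact: D_m (Dh k).
have hge0 k x : (0 <= h k x)%R by exact: D_0 (Dh k) x.
have hh0P P : M P -> {ae P, forall x, h ^~ x @ \oo --> h0 x}.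
  by move=> MP; apply: ae_null_dominates hh0; have [] := eqM _ _ MP MP0.
have limP P A (a : \bar R) : M P -> measurable A ->
    (forall k, a <= \int[P]_(x in A) (h k x)%:E) ->
    a <= \int[P]_(x in A) (h0 x)%:E.
  move=> MP mA ah; apply: (le_integral_uniform_tail P h) => //; first exact: hh0P.
  move=> e e0; have [c c0 hc] := is_hedge_tail _ _ _ _ _ MP (UI _ MP) hxi0 alpha00 e0.
  exists c => // k; apply: hc (hh k) _; by case/andP: (al1 k).
have Eh k P : M P -> \int[P]_x (h k x)%:E = (al k)%:E by move=> MP; have [_ _ ->] := hh k.
(* Fatou gives one inequality; the uniform tail bound on the whole space, with all prices at least
   [f0], gives the other. *)
have Eh0 P : M P -> \int[P]_x (h0 x)%:E = f0%:E.
  move=> MP; apply/eqP; rewrite eq_le; apply/andP; split.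
    apply: (ae_fatou P h) => //; first exact: hh0P.
    by under eq_fun do rewrite Eh//.
  apply: limP => // k; rewrite Eh// lee_fin; by case/andP: (al1 k).
exists h0; split => //.
- move=> P MP; apply/integrableP; split; first exact/measurable_EFinP.
  rewrite (eq_integral (EFin \o h0)); last by move=> x _ /=; rewrite ger0_norm.
  by rewrite Eh0// ltry.
- move=> P MP A GA; apply: limP => //; first exact: Gm.
  by move=> k; have [_ _ _ ->] := hh k.
Qed.

(** * The filtration, attained prices and the local regular case *)

Lemma filtration_sub_measurable {d} {T : measurableType d}
    (F : nat -> set (set T)) (n : nat) :
  is_filtration F -> F n `<=` measurable.
Proof.
move=> [_ Fnd _ ->] A FA; apply: sub_sigma_algebra.
(* The generating union starts at index 1, so [F 0] enters through [F 1]. *)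
by exists n.+1 => //; exact: (Fnd _ _ (leqnSn n)).
Qed.

Lemma gmeasurable_trivial {d} {T : measurableType d} {R : realType}
    (X : T -> R) :
  gmeasurable [set set0; [set: T]] X -> exists c, forall x, X x = c.
Proof.
move=> GX; exists (X point) => x.
have [E|E] := GX [set X point] (measurable_set1 _).
- by have : (X @^-1` [set X point]) point by []; rewrite E.
- by have : (X @^-1` [set X point]) x by rewrite E.
Qed.

Lemma integral_cst_probability {d} {T : measurableType d} {R : realType}
    (P : probability T R) (c : R) : \int[P]_x c%:E = c%:E.
Proof. by rewrite integral_cst//= [P _]probability_setT mule1. Qed.

Lemma is_fair_price_attained {d} {T : measurableType d} {R : realType}
    (M : set (probability T R)) (G : set (set T)) (fN : T -> R)
    (alpha0 f0 : R) :
  f0 = inf (price_set M G fN alpha0) -> price_set M G fN alpha0 f0 ->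
  is_fair_price M G fN alpha0 f0.
Proof.
move=> f0E [f00 [xi hxi Hxi]]; split => //.
exists xi, (cst f0), (cst xi); split => //; first exact: cvg_cst.
move=> P MP e e0.
rewrite (_ : (fun n => _) = cst 0); first exact: cvg_cst.
apply/funext => n /=; rewrite (_ : [set x | _] = set0) ?measure0//.
by apply/seteqP; split => // x /=; rewrite subrr normr0 leNgt e0.
Qed.

Lemma local_regular_hedge {d} {T : measurableType d} {R : realType}
    (F : nat -> set (set T)) (M : set (probability T R)) (P0 : probability T R)
    (N : nat) (fN : T -> R) (f : nat -> T -> R) (s : R) :
  is_filtration F -> M P0 -> pairwise_equivalent M ->
  (forall x, (0 <= fN x)%R) -> gmeasurable (F N) fN ->
  (forall P, M P -> P.-integrable [set: T] (EFin \o fN)) ->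
  (forall P, M P -> \int[P]_x (fN x)%:E <= s%:E) ->
  (forall m, is_family_ess_sup P0 [set cond_exp P (F m) fN | P in M] (f m)) ->
  local_regular F M f ->
  exists c eta, [/\ (0 <= c <= s)%R & is_hedge M (F N) fN c eta].
Proof.
move=> hF MP0 eqM fN0 GfN ifN fNs fess [[adf _] _ [g [[adg g0 _ g00] _ mart]]].
have [sF Fnd F0 _] := hF.
have Fm n := filtration_sub_measurable F n hF.
have F0T n : F n [set: T].
  by have [F00 FC _] := sF n; rewrite -(setD0 [set: T]); exact: FC.
have cstF0 (X : T -> R) : gmeasurable (F 0%N) X -> exists c, forall x, X x = c.
  by rewrite F0; exact: gmeasurable_trivial.
have [c fc] := cstF0 _ (adf 0%N).
(* [m >= N] makes [fN] measurable for [F m]; [m >= 1] is needed because integrability is only given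
   from time 1 on. *)
pose m := maxn N 1.
have Nm : (N <= m)%N by rewrite leq_maxl.
have m1 : (1 <= m)%N by rewrite leq_maxr.
pose X x := (f m x + g m x)%R.
have iX P : M P -> P.-integrable [set: T] (EFin \o X).
  by move=> MP; have [_ + _] := mart _ MP; exact.
(* The martingale property between times 0 and [m], where [f 0] is the constant [c] and [g 0] is
   0. *)
have EX P : M P -> \int[P]_x (X x)%:E = c%:E.
  move=> MP; have [_ _ /(_ _ _ (leq0n m)) mX] := mart _ MP.
  have [GY iY EY] := is_cond_exp_cond_exp P (F 0%N) X (sF 0%N) (Fm 0%N) (iX _ MP).
  rewrite -(EY _ (F0T 0%N)) -(integral_cst_probability P).
  apply: ae_eq_integral => //; first exact: measurable_int iY.
  by apply: filterS mX => x + _; rewrite fc g00 addr0 => ->.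
(* Conditional expectations given the trivial [F 0] are the constant means of [fN], so the constant
   [s] is an upper bound of the family defining [f 0]. *)
have cs : (c <= s)%R.
  have [_ _ /(_ (cst s)) f0s] := fess 0%N.
  have : {ae P0, forall x, (f 0%N x <= s)%R}.
    apply: f0s => // _ [P MP <-]; apply: aeW => x.
    have [GY iY EY] := is_cond_exp_cond_exp P (F 0%N) fN (sF 0%N) (Fm 0%N) (ifN _ MP).
    have [k Yk] := cstF0 _ GY.
    have := fNs _ MP; rewrite -(EY _ (F0T 0%N)).
    by under eq_integral do rewrite Yk; rewrite integral_cst_probability lee_fin Yk.
  move=> f0s'; rewrite -lee_fin -(integral_cst_probability P0 c).
  rewrite -(integral_cst_probability P0 s).
  apply: ae_le_integral => //; [exact: finite_measure_integrable_cst..|].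
  by apply: filterS f0s' => x; rewrite fc.
(* Almost surely [fN] is at most its conditional expectation given [F m] under [P0], a member of the
   family bounded by [f m], and [g m] is nonnegative. *)
have fNX0 : {ae P0, forall x, (fN x <= X x)%R}.
  have [_ /(_ (cond_exp P0 (F m) fN)) fub _] := fess m.
  have [GY iY EY] := is_cond_exp_cond_exp P0 (F m) fN (sF m) (Fm m) (ifN _ MP0).
  have fNY : {ae P0, forall x, (fN x <= cond_exp P0 (F m) fN x)%R}.
    apply: (ae_le_of_integral_le P0 (F m)) => //.
    - by move=> B mB; apply: (Fnd _ _ Nm); exact: GfN.
    - exact: ifN.
    - by move=> A FA; rewrite EY.
  apply: filterS2 fNY (fub _) => [x fY Yf|]; last by exists P0.
  by rewrite (le_trans fY)// (le_trans Yf)// /X lerDl.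
have fNX P : M P -> {ae P, forall x, (fN x <= X x)%R}.
  by move=> MP; apply: ae_null_dominates fNX0; have [] := eqM _ _ MP MP0.
have inX P : M P -> P.-integrable [set: T] (EFin \o (fun x => `|X x|%R)).
  by move=> MP; apply: integrable_norm; exact: iX.
have EnX P : M P -> \int[P]_x (`|X x|%R)%:E = c%:E.
  move=> MP; rewrite -(EX _ MP); apply: ae_eq_integral => //.
  - exact: measurable_int (inX _ MP).
  - exact: measurable_int (iX _ MP).
  by apply: filterS (fNX _ MP) => x fX _; rewrite ger0_norm// (le_trans (fN0 x)).
(* Since [X >= fN >= 0] almost surely, the absolute value only changes [X] on a null set, and gives
   the nonnegativity at every point that a hedge requires. *)
exists c, (fun x => `|X x|%R); split.
  rewrite cs andbT -lee_fin -(EnX _ MP0).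
  by apply: integral_ge0 => x _; rewrite lee_fin.
split => // P MP A FA; apply: ae_le_integral => //.
- exact: Fm FA.
- exact: ifN.
- exact: inX.
- apply: filterS (fNX _ MP) => x fX; exact: (le_trans fX (ler_norm _)).
Qed.

Theorem theorem15 (d : measure_display) (T : measurableType d) (R : realType)
  (F : nat -> set (set T)) (M : set (probability T R)) (P0 : probability T R)
  (hF : is_filtration F)
  (hP0 : M P0)
  (hconv : convex_probabilities M)
  (hequiv : pairwise_equivalent M)
  (hdens : densities_measurable_positive (F 1%N) M P0)
  (hUI : forall P, M P -> uniformly_integrable P (A0 M))
  (N : nat) (fN : T -> R)
  (fN_ge0 : forall x, (0 <= fN x)%R)
  (fN_meas : gmeasurable (F N) fN)
  (fN_int : forall P, M P -> P.-integrable [set: T] (EFin \o fN))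
  (alpha0 : R) (xi0 : T -> R)
  (halpha0 : (0 <= alpha0)%R)
  (hxi0 : A0 M xi0)
  (hdom : superhedged M (F N) fN alpha0 xi0) :
  exists f0 : R,
    [/\ is_fair_price M (F N) fN alpha0 f0,
        ereal_sup [set 'E_P[fN] | P in M] <= f0%:E &
        forall f : nat -> T -> R,
          (forall m, is_family_ess_sup P0
             [set cond_exp P (F m) fN | P in M] (f m)) ->
          local_regular F M f ->
          f0%:E = ereal_sup [set 'E_P[fN] | P in M]].
Proof.
have [sF _ _ _] := hF.
have Fm := filtration_sub_measurable F N hF.
pose S := price_set M (F N) fN alpha0.
pose f0 := inf S.
have Salpha0 : S alpha0 by split; [rewrite halpha0 lexx|exists xi0].
have lbS : lbound S 0%R by move=> a [/andP[]].
have infS : has_inf S by split; [exists alpha0|exists 0%R].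
have f0_le a : S a -> (f0 <= a)%R by move=> Sa; apply: ge_inf => //; exists 0%R.
have f0_ge0 : (0 <= f0)%R by apply: lb_le_inf => //; exists alpha0.
have hedge_price a eta : (0 <= a <= alpha0)%R -> is_hedge M (F N) fN a eta -> S a.
  move=> a01 heta; split => //; case/andP: a01 => a0 _.
  exact: (superhedged_is_hedge M (F N) fN a xi0 eta).
have [eta heta] : exists eta, is_hedge M (F N) fN f0 eta.
  apply: (is_hedge_limit M P0 (F N) fN alpha0 f0 xi0) => // n.
  have n0 : (0 < n.+1%:R^-1 :> R)%R by rewrite invr_gt0.
  have [a Sa af0] := inf_adherent n0 infS.
  have [/andP[a0 aalpha0] [xi hxi Hxi]] := Sa.
  exists a, (fun x => a * xi x)%R; split.
  - by rewrite f0_le.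
  - exact: ltW.
  - exact: is_hedge_superhedged.
(* The hedging inequality on the whole space. *)
have sup_le : ereal_sup [set 'E_P[fN] | P in M] <= f0%:E.
  apply: ge_ereal_sup => _ [P MP <-]; rewrite expectationE.
  have [_ _ Eeta hle] := heta; rewrite -(Eeta _ MP); apply: hle => //.
  by have [F0 FC _] := sF N; rewrite -(setD0 [set: T]); exact: FC.
exists f0; split => //.
  apply: is_fair_price_attained => //.
  by apply: hedge_price heta; rewrite f0_ge0 f0_le.
move=> f fess flr; apply/eqP; rewrite eq_le sup_le andbT.
have E_le P : M P -> 'E_P[fN] <= ereal_sup [set 'E_P[fN] | P in M].
  by move=> MP; apply: ereal_sup_ubound; exists P.
(* The supremum lies between [E fN >= 0] under [P0] and [f0], so it may be replaced by a real
   [s]. *)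
have sup_fin : ereal_sup [set 'E_P[fN] | P in M] \is a fin_num.
  rewrite ge0_fin_numE; first exact: le_lt_trans sup_le (ltry _).
  by apply: le_trans (E_le _ hP0); exact: expectation_ge0.
move: sup_le E_le; rewrite -(fineK sup_fin) !lee_fin.
set s := fine _ => sup_le E_le.
have [c [xi [/andP[c0 cs] hc]]] : exists c eta,
    [/\ (0 <= c <= s)%R & is_hedge M (F N) fN c eta].
  apply: (local_regular_hedge F M P0 N fN f) => // P MP.
  by rewrite -expectationE; exact: E_le.
(* From [c <= s <= f0 <= alpha0] the price [c] is admissible, whence [f0 <= c <= s]. *)
apply: (le_trans (f0_le c _) cs); apply: (hedge_price c _ _ hc).
by rewrite c0 (le_trans cs)// (le_trans sup_le)// f0_le.
Qed.
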